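(* Let $X$ be a smooth projective toric variety, let $\{h_1,\dots,h_N\}$ be the Hilbert basis of $\mathrm{Nef}(X)\cap\mathrm{Pic}(X)$, and let $0\ne D\in\mathrm{Nef}(X)\cap\mathrm{Pic}(X)$. Let $\lambda\in\mathrm{Pic}(X)^\vee_{\mathbb R}=\mathrm{Hom}(\mathrm{Pic}(X),\mathbb R)$ satisfy $\lambda(h_j)\ge1$ for $1\le j\le N$. Then $$\tau_X(D;\mathbb Q)\le\lambda(D).$$
   Context: All toric varieties are over an algebraically closed field. For a smooth projective toric variety $X$ and a nonzero class $D\in\mathrm{Nef}(X)\cap\mathrm{Pic}(X)$, put $$\tau_X(D;\mathbb Q)=\sup\Big\{\sum_{i=1}^r a_i\ \Big|\ D=\sum_{i=1}^r a_iD_i\ \text{in }\mathrm{Pic}(X)\otimes\mathbb Q,\ 0\ne D_i\in\mathrm{Nef}(X)\cap\mathrm{Pic}(X),\ a_i\in\mathbb Q_{>0}\Big\}.$$ Hilbert basis. For a lattice $L$ and a strongly convex rational polyhedral cone $C\subset L_{\mathbb R}$, the Hilbert basis of $\Gamma=C\cap L$ is the unique minimal finite generating set of the monoid $\Gamma$, equivalently the set of $h\in\Gamma\setminus\{0\}$ that are not of the form $u+v$ with $u,v\in\Gamma\setminus\{0\}$. Here $C=\mathrm{Nef}(X)$ and $L=\mathrm{Pic}(X)$. *)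

(* Defs.v *)
From HB Require Import structures.
From mathcomp Require Import -(notations) mpoly.
From mathcomp Require Import all_boot all_order all_algebra.
From mathcomp Require Import all_classical all_reals all_analysis.

Set Implicit Arguments.
Unset Strict Implicit.
Unset Printing Implicit Defensive.
Import Order.TTheory GRing.Theory Num.Theory.
Local Open Scope classical_set_scope.
Local Open Scope quotient_scope.
Local Open Scope ring_scope.

(* Varieties are classical projective varieties over an algebraically closed
   field: sets of closed points of P^n with the Zariski topology, and regular
   functions that are locally quotients of forms of the same degree.  The
   definitions make sense over any field but are meant for closed ones.  The
   notations of mpoly clash with those of the analysis library. *)

Notation mpol n R := (mpoly n R).

Definition homog {R : nzRingType} {n : nat} (d : nat) : set (mpol n R) :=
  [set p | p \is ishomog1 d (@mdeg n)].

(** * Projective space *)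

(* A point of P^n is represented by its unique homogeneous coordinate vector
   whose first nonzero entry is 1. *)
Definition normalized (k : fieldType) (n : nat) (v : 'rV[k]_n.+1) : bool :=
  [exists i, (v 0 i == 1) && [forall j : 'I_n.+1, (j < i)%N ==> (v 0 j == 0)]].

Record pspace (k : fieldType) (n : nat) := PSpace {
  coords : 'rV[k]_n.+1;
  _ : normalized coords
}.

HB.instance Definition _ (k : fieldType) (n : nat) :=
  [isSub for @coords k n].
HB.instance Definition _ (k : fieldType) (n : nat) :=
  [Choice of pspace k n by <:].

Definition heval (k : fieldType) (n : nat) (p : mpol n.+1 k) (x : pspace k n) : k :=
  meval (fun i => coords x 0 i) p.

(* v is a vector of homogeneous coordinates of x. *)
Definition hcoords (k : fieldType) (n : nat) (v : 'I_n.+1 -> k) (x : pspace k n) :=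
  exists2 c : k, c != 0 & forall i, v i = c * coords x 0 i.

Definition zero_locus (k : fieldType) (n : nat) (S : set (mpol n.+1 k)) :
  set (pspace k n) := [set x | forall p, S p -> heval p x = 0].

Definition zariski_open (k : fieldType) (n : nat) : set (set (pspace k n)) :=
  [set U | exists2 S : set (mpol n.+1 k),
     (forall p, S p -> exists d, homog d p) & ~` U = zero_locus S].

Section ZariskiTopology.
Variables (k : fieldType) (n : nat).

Lemma heval1 (x : pspace k n) : heval 1 x = 1.
Proof. exact: meval1. Qed.

Lemma hevalM (p q : mpol n.+1 k) (x : pspace k n) :
  heval (p * q) x = heval p x * heval q x.
Proof. exact: mevalM. Qed.

Lemma homog1 : homog 0 (1 : mpol n.+1 k).
Proof. exact: dhomog1. Qed.

Lemma homogM d e (p q : mpol n.+1 k) :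
  homog d p -> homog e q -> homog (d + e) (p * q).
Proof. exact: dhomogM. Qed.

Let openT : @zariski_open k n setT.
Proof.
exists [set 1] => [p ->|]; first by exists 0%N; exact: homog1.
rewrite setCT; apply/seteqP; split => // x /(_ 1 erefl).
by rewrite heval1 => /eqP; rewrite oner_eq0.
Qed.

Let openI : setI_closed (@zariski_open k n).
Proof.
move=> A B [S homS AS] [S' homS' BS'].
exists [set r | exists p q, [/\ S p, S' q & r = p * q]].
  move=> _ [p [q [/homS [d pd] /homS' [e qe] ->]]].
  by exists (d + e)%N; exact: homogM.
rewrite setCI AS BS'; apply/seteqP; split => x.
  move=> SSx _ [p [q [Sp Sq ->]]]; rewrite hevalM; apply/eqP.
  by rewrite mulf_eq0; case: SSx => [/(_ p Sp)|/(_ q Sq)] ->; rewrite eqxx ?orbT.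
move=> Sx; have [|/existsNP[p /not_implyP[Sp px]]] := pselect (zero_locus S x).
  by left.
right => q Sq; have /eqP : heval (p * q) x = 0 by apply: Sx; exists p, q.
by rewrite hevalM mulf_eq0 => /orP[/eqP|/eqP].
Qed.

Let open_bigU (I : Type) (f : I -> set (pspace k n)) :
  (forall i, zariski_open (f i)) -> zariski_open (\bigcup_i f i).
Proof.
move=> fo.
have /choice[S SP] : forall i, exists S : set (mpol n.+1 k),
    (forall p, S p -> exists d, homog d p) /\ ~` f i = zero_locus S.
  by move=> i; have [S homS fS] := fo i; exists S.
exists (\bigcup_i S i).
  by move=> p [i _ Sp]; exact: (SP i).1.
rewrite setC_bigcup; apply/seteqP; split => x.
  by move=> fx p [i _ Sp]; have := fx i Logic.I; rewrite (SP i).2; exact.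
by move=> Sx i _; rewrite (SP i).2 => p Sp; apply: Sx; exists i.
Qed.

HB.instance Definition _ :=
  isOpenTopological.Build (pspace k n) openT openI open_bigU.

End ZariskiTopology.

(** * Varieties and regular functions *)

Definition irreducible_set (T : topologicalType) (A : set T) : Prop :=
  A !=set0 /\ forall B C : set T, closed B -> closed C ->
    A `<=` B `|` C -> A `<=` B \/ A `<=` C.

Record projVariety (k : fieldType) (n : nat) := ProjVariety {
  points :> set (pspace k n);
  points_closed : closed points;
  points_irreducible : irreducible_set points
}.

(* Krull dimension: the maximal length of a chain of irreducible closed subsets. *)
Definition irreducible_chain (T : topologicalType) (X : set T) (m : nat)
    (Z : nat -> set T) : Prop :=
  (forall i, (i <= m)%N -> [/\ closed (Z i), irreducible_set (Z i) & Z i `<=` X]) /\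
  (forall i, (i < m)%N -> Z i `<` Z i.+1).

Definition has_dim (T : topologicalType) (X : set T) (m : nat) : Prop :=
  (exists Z, irreducible_chain X m Z) /\ ~ (exists Z, irreducible_chain X m.+1 Z).

(* phi restricts to a regular function on a neighbourhood of x in X; the values
   of phi away from X and from that neighbourhood are irrelevant. *)
Definition regular_at (k : fieldType) (n : nat) (X : set (pspace k n))
    (phi : pspace k n -> k) (x : pspace k n) : Prop :=
  exists d (p q : mpol n.+1 k),
    [/\ homog d p, homog d q, heval q x != 0
      & \forall y \near x, X y -> phi y = heval p y / heval q y].

Definition unit_at (k : fieldType) (n : nat) (X : set (pspace k n))
    (phi : pspace k n -> k) (x : pspace k n) : Prop :=
  regular_at X phi x /\ phi x != 0.

(* Tangent space at x to the affine cone over X. *)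
Definition cone_tangent (k : fieldType) (n : nat) (X : set (pspace k n))
    (x : pspace k n) : set 'rV[k]_n.+1 :=
  [set v | forall d (p : mpol n.+1 k), homog d p ->
     (forall y, X y -> heval p y = 0) ->
     \sum_(i < n.+1) v 0 i * heval (mderiv i p) x = 0].

(* Jacobian criterion; the cone over X has dimension dim X + 1. *)
Definition smooth (k : fieldType) (n : nat) (X : projVariety k n) : Prop :=
  exists2 d, has_dim X d &
    forall x, points X x -> exists2 V : {vspace 'rV[k]_n.+1},
      \dim V = d.+1 & forall v, v \in V <-> cone_tangent X x v.

(** * Toric varieties *)

Definition torus (k : fieldType) (d : nat) : set 'rV[k]_d :=
  [set t | forall i, t 0 i != 0].

Definition torus_mul (k : fieldType) (d : nat) (s t : 'rV[k]_d) : 'rV[k]_d :=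
  map2_mx *%R s t.

(* Denominators in the torus coordinates can be cleared, so a morphism to P^n is
   given locally by polynomials without common zero. *)
Definition torus_morphism (k : fieldType) (n d : nat)
    (j : 'rV[k]_d -> pspace k n) : Prop :=
  forall t, torus t -> exists G : 'I_n.+1 -> mpol d k,
    let ev s i := meval (fun l => s 0 l) (G i) in
    (exists i, ev t i != 0) /\
    forall s, torus s -> (exists i, ev s i != 0) -> hcoords (ev s) (j s).

(* Morphisms torus * X -> P^n: locally given by polynomials in the torus
   coordinates and the homogeneous coordinates of P^n, homogeneous of a common
   degree in the latter. *)
Definition torus_prod_morphism (k : fieldType) (n d : nat) (X : set (pspace k n))
    (act : 'rV[k]_d -> pspace k n -> pspace k n) : Prop :=
  forall t x, torus t -> X x ->
  exists e (F : 'I_n.+1 -> mpol n.+1 (mpol d k)),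
    let ev s y i :=
      heval (map_mpoly (meval (fun l => s 0 l)) (F i)) y in
    [/\ forall i, homog e (F i),
        exists i, ev t x i != 0 &
        forall s y, torus s -> X y -> (exists i, ev s y i != 0) ->
          hcoords (ev s y) (act s y)].

(* j is an isomorphism from the torus onto an open subset of X: an injective
   morphism with open image whose inverse has regular components. *)
Definition torus_open_immersion (k : fieldType) (n d : nat) (X : set (pspace k n))
    (j : 'rV[k]_d -> pspace k n) : Prop :=
  [/\ torus_morphism j,
      exists2 U, open U & j @` (@torus k d) = X `&` U &
      exists u : 'I_d -> pspace k n -> k, forall t i, torus t ->
        u i (j t) = t 0 i /\ regular_at X (u i) (j t)].

Definition toric (k : fieldType) (n : nat) (X : projVariety k n) : Prop :=
  exists (d : nat) (j : 'rV[k]_d -> pspace k n)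
         (act : 'rV[k]_d -> pspace k n -> pspace k n),
  [/\ torus_open_immersion X j,
      torus_prod_morphism X act,
      forall t x, torus t -> points X x -> points X (act t x),
      (forall x, points X x -> act (const_mx 1) x = x) /\
      (forall s t x, torus s -> torus t -> points X x ->
         act s (act t x) = act (torus_mul s t) x) &
      forall s t, torus s -> torus t -> act s (j t) = j (torus_mul s t)].

(** * Line bundles and the Picard group *)

(* A line bundle on X, given by an open neighbourhood lb_dom x of every point x
   of X over which it is trivialized, and the transition functions lb_tr x y:
   local sections s_x and s_y agree when s_x = lb_tr x y * s_y. *)
Record lineBundle (k : fieldType) (n : nat) (X : projVariety k n) := LineBundle {
  lb_dom : pspace k n -> set (pspace k n);
  lb_tr : pspace k n -> pspace k n -> pspace k n -> k;
  lb_dom_nbhs : forall x, points X x -> open_nbhs x (lb_dom x);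
  lb_tr_unit : forall x y z, points X x -> points X y -> points X z ->
    lb_dom x z -> lb_dom y z -> unit_at X (lb_tr x y) z;
  lb_tr_cocycle : forall x y w z,
    points X x -> points X y -> points X w -> points X z ->
    lb_dom x z -> lb_dom y z -> lb_dom w z ->
    lb_tr x y z * lb_tr y w z = lb_tr x w z
}.

HB.instance Definition _ (k : fieldType) (n : nat) (X : projVariety k n) :=
  gen_eqMixin (lineBundle X).
HB.instance Definition _ (k : fieldType) (n : nat) (X : projVariety k n) :=
  gen_choiceMixin (lineBundle X).

(* An isomorphism is multiplication by a nowhere vanishing regular function h x
   in the trivializations near each point x. *)
Definition lb_iso (k : fieldType) (n : nat) (X : projVariety k n)
    (L M : lineBundle X) : Prop :=
  exists (V : pspace k n -> set (pspace k n)) (h : pspace k n -> pspace k n -> k),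
  [/\ forall x, points X x -> open_nbhs x (V x),
      forall x, points X x -> V x `<=` lb_dom L x `&` lb_dom M x,
      forall x z, points X x -> points X z -> V x z -> unit_at X (h x) z &
      forall x y z, points X x -> points X y -> points X z -> V x z -> V y z ->
        lb_tr M x y z * h y z = h x z * lb_tr L x y z].

Section Picard.
Variables (k : fieldType) (n : nat) (X : projVariety k n).
Implicit Types (L M : lineBundle X) (phi psi : pspace k n -> k).

Lemma unit_at1 x : unit_at X (fun=> 1) x.
Proof.
split; last exact: oner_neq0.
exists 0%N, 1, 1; split; rewrite ?heval1 ?oner_neq0 //; try exact: homog1.
by near=> y => _; rewrite !heval1 divr1.
Unshelve. all: by end_near.
Qed.

Lemma unit_atM phi psi x :
  unit_at X phi x -> unit_at X psi x -> unit_at X (fun y => phi y * psi y) x.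
Proof.
move=> [[d [p [q [pd qd qx phiE]]]] phix] [[e [r [s [re se sx psiE]]]] psix].
split; last by rewrite mulf_neq0.
exists (d + e)%N, (p * r), (q * s); split; try exact: homogM.
  by rewrite hevalM mulf_neq0.
apply: filterS2 phiE psiE => y phiy psiy Xy.
by rewrite phiy // psiy // !hevalM mulf_div.
Qed.

Lemma unit_atV phi x : points X x ->
  unit_at X phi x -> unit_at X (fun y => (phi y)^-1) x.
Proof.
move=> Xx [[d [p [q [pd qd qx phiE]]]] phix].
split; last by rewrite invr_neq0.
exists d, q, p; split => //.
  apply: contraNneq phix => px; have := nbhs_singleton phiE.
  by rewrite px mul0r => ->.
by apply: filterS phiE => y phiy Xy; rewrite phiy // invf_div.
Qed.

Lemma lb_iso_refl L : lb_iso L L.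
Proof.
exists (lb_dom L), (fun _ _ => 1); split=> [x|x Xx z Lz|x z _ _ _|x y z *].
- exact: lb_dom_nbhs.
- by split.
- exact: unit_at1.
- by rewrite mulr1 mul1r.
Qed.

Lemma lb_iso_sym L M : lb_iso L M -> lb_iso M L.
Proof.
move=> [V [h [Vo Vd hu hE]]].
exists V, (fun x y => (h x y)^-1); split => //.
- by move=> x Xx z /(Vd _ Xx)[]; split.
- by move=> x z Xx Xz Vz; apply: unit_atV => //; exact: hu.
move=> x y z Xx Xy Xz Vx Vy; have := hE x y z Xx Xy Xz Vx Vy.
have [_ hx] := hu x z Xx Xz Vx; have [_ hy] := hu y z Xy Xz Vy.
by move=> e; apply: (mulfI hx); rewrite mulrA -e mulfK // mulVKf.
Qed.

Lemma lb_iso_trans M L N : lb_iso L M -> lb_iso M N -> lb_iso L N.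
Proof.
move=> [V [h [Vo Vd hu hE]]] [W [g [Wo Wd gu gE]]].
exists (fun x => V x `&` W x), (fun x y => g x y * h x y); split.
- by move=> x Xx; apply: open_nbhsI; [exact: Vo|exact: Wo].
- by move=> x Xx z [/(Vd _ Xx)[? _] /(Wd _ Xx)[_ ?]].
- by move=> x z Xx Xz [Vz Wz]; apply: unit_atM; [exact: gu|exact: hu].
move=> x y z Xx Xy Xz [Vx Wx] [Vy Wy].
by rewrite mulrA gE // -mulrA hE // mulrA.
Qed.

Definition lb_isob L M : bool := `[< lb_iso L M >].

Lemma lb_isob_refl : reflexive lb_isob.
Proof. by move=> L; apply/asboolP; exact: lb_iso_refl. Qed.

Lemma lb_isob_sym : symmetric lb_isob.
Proof. by move=> L M; apply/asboolP/asboolP; exact: lb_iso_sym. Qed.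

Lemma lb_isob_trans : transitive lb_isob.
Proof.
move=> M L N /asboolP LM /asboolP MN; apply/asboolP.
exact: lb_iso_trans LM MN.
Qed.

Canonical lb_isob_equiv :=
  EquivRel lb_isob lb_isob_refl lb_isob_sym lb_isob_trans.

Program Definition lb_tensor L M : lineBundle X := @LineBundle k n X
  (fun x => lb_dom L x `&` lb_dom M x)
  (fun x y z => lb_tr L x y z * lb_tr M x y z) _ _ _.
Next Obligation.
by move=> L M x Xx; apply: open_nbhsI; exact: lb_dom_nbhs.
Qed.
Next Obligation.
move=> L M x y z Xx Xy Xz [Lx Mx] [Ly My].
by apply: unit_atM; exact: lb_tr_unit.
Qed.
Next Obligation.
move=> L M x y w z Xx Xy Xw Xz [Lx Mx] [Ly My] [Lw Mw] /=.
by rewrite mulrACA !lb_tr_cocycle.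
Qed.

Program Definition lb_trivial : lineBundle X := @LineBundle k n X
  (fun=> setT) (fun _ _ _ => 1) _ _ _.
Next Obligation. by move=> x _; split => //; exact: openT. Qed.
Next Obligation. by move=> *; exact: unit_at1. Qed.
Next Obligation. by move=> *; rewrite mulr1. Qed.

Program Definition lb_dual L : lineBundle X := @LineBundle k n X
  (lb_dom L) (fun x y z => (lb_tr L x y z)^-1) _ _ _.
Next Obligation. by move=> L x Xx; exact: lb_dom_nbhs. Qed.
Next Obligation.
by move=> L x y z Xx Xy Xz Lx Ly; apply: unit_atV => //; exact: lb_tr_unit.
Qed.
Next Obligation.
by move=> L x y w z Xx Xy Xw Xz Lx Ly Lw /=; rewrite -invfM lb_tr_cocycle.
Qed.

Lemma lb_tensor_iso L L' M M' :
  lb_iso L L' -> lb_iso M M' -> lb_iso (lb_tensor L M) (lb_tensor L' M').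
Proof.
move=> [V [h [Vo Vd hu hE]]] [W [g [Wo Wd gu gE]]].
exists (fun x => V x `&` W x), (fun x y => h x y * g x y); split.
- by move=> x Xx; apply: open_nbhsI; [exact: Vo|exact: Wo].
- by move=> x Xx z [/(Vd _ Xx)[? ?] /(Wd _ Xx)[? ?]].
- by move=> x z Xx Xz [Vz Wz]; apply: unit_atM; [exact: hu|exact: gu].
move=> x y z Xx Xy Xz [Vx Wx] [Vy Wy] /=.
by rewrite mulrACA hE // gE // mulrACA.
Qed.

Lemma lb_dual_iso L L' : lb_iso L L' -> lb_iso (lb_dual L) (lb_dual L').
Proof.
move=> [V [h [Vo Vd hu hE]]].
exists V, (fun x y => (h x y)^-1); split => //.
- by move=> x z Xx Xz Vz; apply: unit_atV => //; exact: hu.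
by move=> x y z Xx Xy Xz Vx Vy /=; rewrite -!invfM hE.
Qed.

Lemma lb_iso_eq L M :
  (forall x y z, points X x -> points X y -> points X z ->
     (lb_dom L x `&` lb_dom M x) z -> (lb_dom L y `&` lb_dom M y) z ->
     lb_tr L x y z = lb_tr M x y z) ->
  lb_iso L M.
Proof.
move=> LM; exists (fun x => lb_dom L x `&` lb_dom M x), (fun _ _ => 1).
split=> [x Xx|x Xx z|x z _ _ _|x y z Xx Xy Xz Vx Vy].
- by apply: open_nbhsI; exact: lb_dom_nbhs.
- by [].
- exact: unit_at1.
- by rewrite mulr1 mul1r LM.
Qed.

Definition Pic : Type := {eq_quot lb_isob}.
HB.instance Definition _ := Choice.on Pic.
HB.instance Definition _ := Quotient.on Pic.
HB.instance Definition _ := EqQuotient.on Pic.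

Definition pic_add (a b : Pic) : Pic := \pi_Pic (lb_tensor (repr a) (repr b)).
Definition pic_opp (a : Pic) : Pic := \pi_Pic (lb_dual (repr a)).
Definition pic_zero : Pic := \pi_Pic lb_trivial.

Lemma pic_eqP L M : \pi_Pic L = \pi_Pic M <-> lb_iso L M.
Proof.
split; first by move=> /eqmodP /asboolP.
by move=> LM; apply/eqmodP/asboolP.
Qed.

Lemma pic_surj (a : Pic) : exists L, a = \pi_Pic L.
Proof. by exists (repr a); rewrite reprK. Qed.

Lemma pic_repr L : lb_iso (repr (\pi_Pic L)) L.
Proof. by apply/pic_eqP; rewrite reprK. Qed.

Lemma pic_addE L M :
  pic_add (\pi_Pic L) (\pi_Pic M) = \pi_Pic (lb_tensor L M).
Proof. by apply/pic_eqP/lb_tensor_iso; exact: pic_repr. Qed.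

Lemma pic_oppE L : pic_opp (\pi_Pic L) = \pi_Pic (lb_dual L).
Proof. by apply/pic_eqP/lb_dual_iso; exact: pic_repr. Qed.

Lemma pic_addA : associative pic_add.
Proof.
move=> a b c; have [L ->] := pic_surj a; have [M ->] := pic_surj b.
have [N ->] := pic_surj c; rewrite !pic_addE.
by apply/pic_eqP/lb_iso_eq => x y z * /=; rewrite mulrA.
Qed.

Lemma pic_addC : commutative pic_add.
Proof.
move=> a b; have [L ->] := pic_surj a; have [M ->] := pic_surj b.
rewrite !pic_addE.
by apply/pic_eqP/lb_iso_eq => x y z * /=; rewrite mulrC.
Qed.

Lemma pic_add0 : left_id pic_zero pic_add.
Proof.
move=> a; have [L ->] := pic_surj a; rewrite pic_addE.
by apply/pic_eqP/lb_iso_eq => x y z * /=; rewrite mul1r.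
Qed.

Lemma pic_addN : left_inverse pic_zero pic_opp pic_add.
Proof.
move=> a; have [L ->] := pic_surj a; rewrite pic_oppE pic_addE.
apply/pic_eqP/lb_iso_eq => x y z Xx Xy Xz [[Lx _] _] [[Ly _] _] /=.
by rewrite mulVf //; have [] := @lb_tr_unit _ _ _ L x y z Xx Xy Xz Lx Ly.
Qed.

HB.instance Definition _ :=
  GRing.isZmodule.Build Pic pic_addA pic_addC pic_add0 pic_addN.

End Picard.

(** * Nef classes *)

(* The local ring of C at x modulo the ideal generated by the germ of a has
   dimension m over k, with basis e. *)
Definition colength (k : fieldType) (n : nat) (C : set (pspace k n))
    (x : pspace k n) (a : pspace k n -> k) (m : nat) : Prop :=
  exists2 e : 'I_m -> pspace k n -> k, forall i, regular_at C (e i) x &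
  forall phi, regular_at C phi x -> exists! c : 'rV[k]_m,
    exists2 h, regular_at C h x &
      \forall y \near x, C y -> phi y - \sum_i c 0 i * e i y = a y * h y.

(* Order of vanishing at x, along the curve C, of the homogeneous polynomial p of
   degree d: the colength of p / l for any form l of degree d with l(x) <> 0. *)
Definition vanishing_order (k : fieldType) (n : nat) (C : set (pspace k n))
    (x : pspace k n) (d : nat) (p : mpol n.+1 k) (m : nat) : Prop :=
  exists l : mpol n.+1 k, [/\ homog d l, heval l x != 0 &
    colength C x (fun y => heval p y / heval l y) m].

Definition curve (k : fieldType) (n : nat) (C : set (pspace k n)) : Prop :=
  [/\ closed C, irreducible_set C & has_dim C 1].

(* m is the degree of the restriction of L to the curve C: the degree of the
   divisor of a nonzero rational section of it, equal to p x / q x in the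
   trivialization at x. *)
Definition curve_degree (k : fieldType) (n : nat) (X : projVariety k n)
    (L : lineBundle X) (C : set (pspace k n)) (m : int) : Prop :=
  exists (d : pspace k n -> nat) (p q : pspace k n -> mpol n.+1 k)
         (vp vq : pspace k n -> nat),
  [/\ forall x, C x -> homog (d x) (p x) /\ homog (d x) (q x),
      forall x, C x -> (exists2 z, C z & heval (p x) z != 0) /\
                       (exists2 z, C z & heval (q x) z != 0),
      forall x y z, C x -> C y -> C z -> lb_dom L x z -> lb_dom L y z ->
        heval (p x) z * heval (q y) z =
        lb_tr L x y z * (heval (p y) z * heval (q x) z),
      forall x, C x -> vanishing_order C x (d x) (p x) (vp x) /\
                       vanishing_order C x (d x) (q x) (vq x) &
      m = \sum_(x \in C) ((vp x)%:Z - (vq x)%:Z)].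

Definition nef (k : fieldType) (n : nat) (X : projVariety k n)
    (L : lineBundle X) : Prop :=
  forall C, curve C -> C `<=` X -> exists2 m, curve_degree L C m & 0 <= m.

(* The monoid of integral nef classes. *)
Definition nefPic (k : fieldType) (n : nat) (X : projVariety k n) :
  set (Pic X) := [set c | exists2 L, nef L & c = \pi_(Pic X) L].
Arguments nefPic {k n} X.

(** * Hilbert bases *)

Definition generates (A : nmodType) (G H : set A) : Prop :=
  H `<=` G /\ forall g, G g -> exists2 s : seq A,
    (forall x, x \in s -> H x) & g = \sum_(x <- s) x.

Definition hilbert_basis (A : nmodType) (G H : set A) : Prop :=
  [/\ finite_set H, generates G H &
      forall H' : set A, H' `<=` H -> generates G H' -> H' = H].

(** * The invariant tau *)

(* D = \sum_i a i * E i holds in the localization A (x) Q of A at the nonzero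
   integers: it holds in A after multiplication by some m > 0 clearing the
   denominators of the a i. *)
Definition eq_tensorQ (A : zmodType) (D : A) (r : nat) (a : 'I_r -> rat)
    (E : 'I_r -> A) : Prop :=
  exists (m : nat) (c : 'I_r -> int),
    [/\ (0 < m)%N, forall i, m%:R * a i = (c i)%:~R
      & D *+ m = \sum_i E i *~ c i].

Definition tauQ (R : realType) (k : fieldType) (n : nat) (X : projVariety k n)
    (D : Pic X) : \bar R :=
  ereal_sup [set s | exists r (a : 'I_r -> rat) (E : 'I_r -> Pic X),
    [/\ forall i, nefPic X (E i) /\ E i != 0, forall i, 0 < a i,
        eq_tensorQ D a E & s = (ratr (\sum_i a i))%:E]].

(* Main.v *)
Require Import Defs.
From mathcomp Require Import all_boot all_order all_algebra.
From mathcomp Require Import all_classical all_reals all_analysis.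
Set Implicit Arguments.
Unset Strict Implicit.
Unset Printing Implicit Defensive.
Import Order.TTheory GRing.Theory Num.Theory.
Local Open Scope classical_set_scope.
Local Open Scope ring_scope.

(** A linear form that is at least 1 on the generators of a monoid is at least 1
    on all its nonzero elements, since each of them is a nonempty sum of
    generators ([additive_ge1]).  So [lambda] is at least 1 on every nonzero nef
    class, and applying it to a decomposition [D = \sum_i a i * E i] gives
    [lambda D >= \sum_i a i] ([sum_le_additive]).  The supremum of these sums is
    then bounded by [lambda D]: the bound is weak duality between decompositions
    of [D] and linear forms on the Picard group. *)

Lemma additive_ge1 (R : numDomainType) (A : zmodType) (G H : set A)
    (lambda : {additive A -> R}) (g : A) :
  generates G H -> (forall x, H x -> 1 <= lambda x) ->
  G g -> g != 0 -> 1 <= lambda g.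
Proof.
move=> [_ genG] lambdaH /genG[[|x s] sH ->]; first by rewrite big_nil eqxx.
rewrite big_cons raddfD raddf_sum => _.
rewrite -[1]addr0; apply: lerD; first by apply/lambdaH/sH; rewrite mem_head.
rewrite big_seq; apply: sumr_ge0 => y ys; apply: le_trans ler01 _.
by apply/lambdaH/sH; rewrite in_cons ys orbT.
Qed.

(** The relation [D = \sum_i a i * E i] is only available in the group itself
    after multiplication by a common denominator [m], so the two sides are
    compared after scaling by [m]. *)
Lemma sum_le_additive (R : realType) (A : zmodType) (D : A) (r : nat)
    (a : 'I_r -> rat) (E : 'I_r -> A) (lambda : {additive A -> R}) :
  eq_tensorQ D a E -> (forall i, 0 <= a i) -> (forall i, 1 <= lambda (E i)) ->
  ratr (\sum_i a i) <= lambda D.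
Proof.
move=> [m [c [m_gt0 ac DE]]] a_ge0 lambdaE.
have mR : 0 < m%:R :> R by rewrite ltr0n.
rewrite -(ler_pM2l mR) [leRHS]mulr_natl -raddfMn DE !raddf_sum mulr_sumr /=.
apply: ler_sum => i _.
rewrite -[m%:R](ratr_nat R) -rmorphM ac /= ratr_int raddfMz -[leRHS]mulrzr.
apply: ler_peMl => //.
by rewrite ler0z -(ler0z rat) -ac mulr_ge0 // ler0n.
Qed.

Theorem corollary2p6 (R : realType) (k : closedFieldType) (n : nat)
    (X : projVariety k n) (Xsmooth : smooth X) (Xtoric : toric X)
    (N : nat) (h : 'I_N -> Pic X) (h_inj : injective h)
    (hP : hilbert_basis (nefPic X) (range h))
    (D : Pic X) (Dnef : nefPic X D) (D0 : D != 0)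
    (lambda : {additive Pic X -> R}) (lambda_ge1 : forall j, 1 <= lambda (h j)) :
  (tauQ R D <= (lambda D)%:E)%E.
Proof.
have [_ genP _] := hP.
apply: ge_ereal_sup => _ [r [a [E [EP a_gt0 DE ->]]]].
rewrite lee_fin; apply: (sum_le_additive DE) => i; first exact: ltW.
have [Enef E0] := EP i.
by apply: (additive_ge1 genP _ Enef E0) => _ [j _ <-].
Qed.
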